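(* Let $k\geq 6$ be an integer with $k\equiv 2\pmod 4$. Then there exists a $k$-ARCS$(2kt+1)$ (an almost resolvable $k$-cycle system of order $2kt+1$) for all integers $t\geq 1$, except possibly when $t=2$ and $k\geq 14$. (That is, existence is asserted for every pair $(k,t)$ with $k\ge 6$, $k\equiv 2 \pmod 4$, $t\geq 1$, such that it is not the case that both $t=2$ and $k\geq 14$.)
   Context: $K_v$ denotes the complete graph on $v$ vertices. A $k$-cycle is a cycle of length $k$. A $k$-cycle system of order $v$ is a collection of $k$-cycles (subgraphs of $K_v$) whose edge sets partition $E(K_v)$. In a $k$-cycle system of order $v\equiv 1\pmod{2k}$, an almost parallel class is a collection of $(v-1)/k$ pairwise vertex-disjoint $k$-cycles of the system, and a half-parallel class is a collection of $(v-1)/(2k)$ pairwise vertex-disjoint $k$-cycles of the system. For $v\equiv 1\pmod{2k}$, an almost resolvable $k$-cycle system of order $v$, denoted $k$-ARCS$(v)$, is a $k$-cycle system of order $v$ whose set of cycles can be partitioned into $(v-1)/2$ almost parallel classes and one half-parallel class. *)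

(* Defs.v *)
From mathcomp Require Import all_boot.

Set Implicit Arguments.
Unset Strict Implicit.
Unset Printing Implicit Defensive.

Section CycleSystems.

Variable v : nat.

(* Edges of K_v are the two-element subsets of 'I_v.  A cycle has no isolated
   vertex, so as a subgraph of K_v it is represented by its edge set. *)
Definition edge := {set 'I_v}.
Definition subgraph := {set edge}.

Definition complete_graph : subgraph := [set e : edge | #|e| == 2].

Definition vertices (C : subgraph) : {set 'I_v} := cover C.

(* The closed walk through s: [next s x] wraps around to the head of s. *)
Definition cycle_edges (s : seq 'I_v) : subgraph :=
  [set [set x; next s x] | x in s].

Definition kcycle (k : nat) (C : subgraph) : Prop :=
  2 < k /\ exists s : seq 'I_v, [/\ uniq s, size s = k & C = cycle_edges s].

Definition kcycle_system (k : nat) (S : {set subgraph}) : Prop :=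
  (forall C, C \in S -> kcycle k C) /\ partition S complete_graph.

Definition vertex_disjoint (P : {set subgraph}) : Prop :=
  {in P &, forall C D, C != D -> [disjoint vertices C & vertices D]}.

Definition almost_parallel_class (k : nat) (S P : {set subgraph}) : Prop :=
  [/\ P \subset S, #|P| = v.-1 %/ k & vertex_disjoint P].

Definition half_parallel_class (k : nat) (S P : {set subgraph}) : Prop :=
  [/\ P \subset S, #|P| = v.-1 %/ (2 * k) & vertex_disjoint P].

(* A is the family of almost parallel classes, H the half-parallel class. *)
Definition ARCS (k : nat) (S : {set subgraph}) : Prop :=
  [/\ v = 1 %[mod 2 * k],
      kcycle_system k S &
      exists (A : {set {set subgraph}}) (H : {set subgraph}),
        [/\ #|A| = v.-1 %/ 2,
            forall P, P \in A -> almost_parallel_class k S P,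
            half_parallel_class k S H,
            H \notin A &
            partition (H |: A) S]].

End CycleSystems.

(* Main.v *)
Require Import Defs.
From mathcomp Require Import all_boot all_algebra zify ring.

(** Write k = 2m with m = 2h + 1 odd, and count edges: a family that has the right
numbers of classes and of closed k-walks, in which each class reaches all vertices
but one, the half class repeats no vertex, and every two vertices are joined
somewhere, has exactly as many places as there are vertices and edges to put in
them. Hence it is an almost resolvable system, and coverage alone has to be
checked ([ARCS_of_covering]).

Orders 2k + 1 and 4k + 1. The vertices are infinity and the pairs of a residue
modulo m and one of N labels, where N is 4 or 8. The zigzag 0, 1, -1, 2, -2, ...
through the residues has the same difference at its steps n and m - n. A base
class consists of N zigzags whose labels are permuted at every step, linked in
pairs at both ends into k-cycles, with infinity in place of one vertex; the edges
lost by this replacement form the half-parallel class. There are N / 2 base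
classes, so each difference comes with N permutations of the labels, and what is
needed is that they form a Latin square. For the inner steps the translations of
an elementary abelian 2-group do; they preserve differences of labels, so the
first and the last step, which also have to take care of the links, can be chosen
once and for all, independently of m ([latin_zigzag_covering],
[latin_covering1], [latin_covering2]).

Orders 2kt + 1 with t > 2. The vertices are infinity and t groups of 2k points, a
point being a residue modulo m with one of four labels. Each group together with
infinity carries a system of order 2k + 1, whose classes are completed by classes
of cycles between the other groups. Zigzags between two groups, with suitable
labels, either factor all edges between them into k-cycles or split them into two
halves that can be chained along a cycle of groups, if the cycle uses an even
number of second halves ([edge_cover], [left_in_half], [right_in_half]). So it is
enough to find a scheme on the set of groups: for each group, an arrangement of
the other groups into pairs and longer cycles, such that every two groups are
paired once, or are consecutive in two cycles, once for each half
([scheme_covering]). If t is odd, the reflections of the residues modulo t give a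
scheme of pairs only ([scheme_odd]). If t > 4 is even, reflections of the residues
modulo t - 1 are modified at five residues to make room for infinity and a
triangle ([scheme_even]); for t = 4 there are the four triangles ([scheme4]). *)

Set Implicit Arguments.
Unset Strict Implicit.
Unset Printing Implicit Defensive.

Import GRing.Theory.

Local Notation bit2 := (bool * bool)%type.

(** * Closed walks and the edges they join *)

(** Indexing a closed walk by natural numbers below [k], with the successor taken
modulo [k], lets a cycle be handled before its vertices are known to be distinct. *)
Definition joins (T : Type) (k : nat) (c : nat -> T) (x y : T) : Prop :=
  exists2 n, n < k &
    (c n = x /\ c (n.+1 %% k) = y) \/ (c n = y /\ c (n.+1 %% k) = x).

(** Disjointness inside a class, distinctness of the cycles and uniqueness of the
cycle through an edge are left out because counting returns them. The half class
is too small to be controlled in this way, so it has to be injective. *)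
Record arcs_covering (k : nat) (T I J H : Type)
    (cyc : I -> J -> nat -> T) (half : H -> nat -> T) : Prop := ArcsCovering {
  class_covers : forall i, exists m, forall x, x <> m ->
    exists j, exists2 n, n < k & cyc i j n = x;
  half_inj : forall h h' n n', n < k -> n' < k ->
    half h n = half h' n' -> h = h' /\ n = n';
  edges_covered : forall x y, x <> y ->
    (exists i, exists j, joins k (cyc i j) x y) \/
    (exists h, joins k (half h) x y)
}.

Lemma joins_map (T T' : Type) (f : T -> T') k c x y :
  joins k c x y -> joins k (f \o c) (f x) (f y).
Proof.
by case=> n nk e; exists n => //=; case: e => [[-> ->]|[-> ->]]; [left | right].
Qed.

Lemma arcs_covering_transport k (T T' I J H : Type) (f : T -> T') (g : T' -> T)
    (cyc : I -> J -> nat -> T) (half : H -> nat -> T) :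
    cancel f g -> cancel g f -> arcs_covering k cyc half ->
  arcs_covering k (fun i j => f \o cyc i j) (fun h => f \o half h).
Proof.
move=> fK gK [cls hinj edg]; split.
- move=> i; have [m Hm] := cls i; exists (f m) => x xm.
  have [|j [n nk e]] := Hm (g x).
    by move=> e; apply: xm; rewrite -e gK.
  by exists j, n => //=; rewrite e gK.
- by move=> h h' n n' nk n'k /(can_inj fK); apply: hinj.
- move=> x y xy; rewrite -[x]gK -[y]gK.
  case: (edg (g x) (g y)).
  + by move=> /(can_inj gK).
  + by move=> [i [j e]]; left; exists i, j; apply: joins_map.
  + by move=> [h e]; right; exists h; apply: joins_map.
Qed.

Section CycleEdges.

Variable v : nat.
Implicit Types (s : seq 'I_v) (c : nat -> 'I_v).

Lemma next_mkseq c k n : uniq (mkseq c k) -> n < k ->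
  next (mkseq c k) (c n) = c (n.+1 %% k).
Proof.
case: k => // k Us nk.
have cs : c n \in mkseq c k.+1 by apply/mapP; exists n; rewrite ?mem_iota.
have idx : index (c n) (mkseq c k.+1) = n.
  by rewrite -(nth_mkseq (c n) c nk) index_uniq ?size_mkseq.
rewrite next_nth cs idx /=; have [nk1|kn] := ltnP n k.
  by rewrite (nth_map 0) ?size_iota // nth_iota // modn_small.
rewrite nth_default ?size_map ?size_iota //.
by have -> : n = k by [apply/eqP; rewrite eqn_leq -ltnS nk]; rewrite modnn.
Qed.

Lemma card_cycle_edges s : #|cycle_edges s| <= size s.
Proof. exact: leq_trans (leq_imset_card _ _) (card_size _). Qed.

Lemma cover_cycle_edges s : {subset vertices (cycle_edges s) <= s}.
Proof.
move=> x /bigcupP[e /imsetP[y ys ->]].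
by rewrite !inE => /orP[] /eqP-> //; rewrite mem_next.
Qed.

Lemma joins_cycle_edges c k x y : uniq (mkseq c k) -> joins k c x y ->
  [set x; y] \in cycle_edges (mkseq c k).
Proof.
move=> Us [n nk e].
suff: [set c n; c (n.+1 %% k)] \in cycle_edges (mkseq c k).
  by case: e => [[-> ->]|[-> ->]] //; rewrite setUC.
rewrite -next_mkseq //; apply: imset_f.
by apply/mapP; exists n; rewrite ?mem_iota.
Qed.

Lemma cycle_edges_sub c k : uniq (mkseq c k) -> 1 < k ->
  cycle_edges (mkseq c k) \subset complete_graph v.
Proof.
move=> Us k1; apply/subsetP => e /imsetP[x /mapP[n]].
rewrite mem_iota /= => nk -> ->; rewrite inE next_mkseq // cards2.
have k0 : 0 < k by apply: ltnW.
suff: c n != c (n.+1 %% k) by case: (_ == _).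
have n'k : n.+1 %% k < k by rewrite ltn_mod.
apply/eqP => /(mkseq_uniqP _ _ Us n (n.+1 %% k) nk n'k) ee.
case: (ltngtP n.+1 k) nk => // [nk|ek] _; first by rewrite modn_small // in ee; lia.
by rewrite ek modnn in ee; lia.
Qed.

End CycleEdges.

(** * Coverage and counting *)

Section Counting.

Variables (k t : nat) (I J H : finType).
Let v := 2 * k * t + 1.
Variables (cyc : I -> J -> nat -> 'I_v) (half : H -> nat -> 'I_v).
Hypotheses (k2 : 2 < k) (t0 : 0 < t).
Hypotheses (cardI : #|I| = k * t) (cardJ : #|J| = 2 * t) (cardH : #|H| = t).
Hypothesis cov : arcs_covering k cyc half.

Let walk (x : I * J + H) : nat -> 'I_v :=
  match x with inl (i, j) => cyc i j | inr h => half h end.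
Let walk_edges x : subgraph v := cycle_edges (mkseq (walk x) k).

(** A class has as many vertex slots as there are vertices besides the missed one,
so covering them forces the slots to be filled injectively. *)
Lemma class_inj i : injective (fun p : J * 'I_k => cyc i p.1 p.2).
Proof.
have [m Hm] := class_covers cov i; set f := fun p => _.
suff /imset_injP inj : #|f @: setT| == #|[set: J * 'I_k]|.
  by move=> p q; apply: inj; rewrite inE.
rewrite eqn_leq leq_imset_card /= cardsT card_prod card_ord cardJ.
have <- : #|[set~ m]| = 2 * t * k by rewrite cardsC1 card_ord /v; lia.
apply/subset_leq_card/subsetP => x; rewrite !inE => /eqP xm.
have [j [n nk e]] := Hm x xm.
by apply/imsetP; exists (j, Ordinal nk).
Qed.

Lemma walk_uniq x : uniq (mkseq (walk x) k).
Proof.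
apply/mkseq_uniqP => n n' nk n'k; case: x => [[i j]|h] /= e.
- by case: (@class_inj i (j, Ordinal nk) (j, Ordinal n'k) e).
- by case: (half_inj cov nk n'k e).
Qed.

Lemma walk_edges_sub x : walk_edges x \subset complete_graph v.
Proof. by apply: cycle_edges_sub (walk_uniq x) _; apply: ltnW. Qed.

Lemma card_walk_edges x : #|walk_edges x| <= k.
Proof. by rewrite -[leqRHS](size_mkseq (walk x)) card_cycle_edges. Qed.

Let system := [set walk_edges x | x : I * J + H].

Lemma cover_system : cover system = complete_graph v.
Proof.
apply/eqP; rewrite eqEsubset; apply/andP; split.
  by apply/bigcupsP => e /imsetP[x _ ->]; apply: walk_edges_sub.
apply/subsetP => e; rewrite inE => /cards2P[x [y [xy ->]]].
have [x0 jx] : exists x0, joins k (walk x0) x y.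
  case: (edges_covered cov (elimN eqP xy)) => [[i [j e1]]|[h e1]].
  - by exists (inl (i, j)).
  - by exists (inr h).
apply/bigcupP; exists (walk_edges x0); first exact: imset_f.
exact: joins_cycle_edges (walk_uniq x0) jx.
Qed.

Lemma card_cycles : #|{: I * J + H}| * k = #|complete_graph v|.
Proof.
rewrite card_sum card_prod cardI cardJ cardH /complete_graph card_draws card_ord.
rewrite bin2; have -> : v * v.-1 = (k * t * (2 * t) + t) * k * 2.
  by rewrite /v addn1 /=; nia.
by rewrite muln2 doubleK.
Qed.

Lemma sum_card_system : \sum_(C in system) #|C| <= #|system| * k.
Proof.
rewrite -sum_nat_const; apply: leq_sum => C /imsetP[x _ ->]; exact: card_walk_edges.
Qed.

(** The cycles offer exactly as many edge slots as there are edges, and they reach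
all edges; hence no two indices give the same cycle. *)
Lemma card_system : #|system| = #|{: I * J + H}|.
Proof.
apply/eqP; rewrite eqn_leq leq_imset_card /=.
rewrite -(leq_pmul2r (ltnW (ltnW k2))) card_cycles -cover_system.
exact: leq_trans (leq_card_cover system) sum_card_system.
Qed.

Lemma walk_edges_inj : injective walk_edges.
Proof.
suff /imset_injP inj : #|walk_edges @: setT| == #|[set: I * J + H]|.
  by move=> p q; apply: inj; rewrite inE.
have -> : walk_edges @: setT = system.
  by apply/setP => C; apply/imsetP/imsetP => -[x _ ->]; exists x.
by rewrite cardsT card_system.
Qed.

(** The same equality of counts leaves no room for an edge lying on two cycles. *)
Lemma trivIset_system : trivIset system.
Proof.
have := leq_card_cover system => -[le1 <-]; rewrite eqn_leq le1 /=.
by rewrite cover_system -card_cycles -card_system sum_card_system.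
Qed.

Lemma walk_edges_neq0 x : walk_edges x != set0.
Proof.
apply/set0Pn; have k0 : 0 < k by apply: ltnW (ltnW k2).
exists [set walk x 0; walk x (1 %% k)].
by apply: joins_cycle_edges (walk_uniq x) _; exists 0 => //; left.
Qed.

Lemma partition_system : partition system (complete_graph v).
Proof.
rewrite /partition cover_system eqxx trivIset_system /=; apply/imsetP => -[x _ e].
by have := walk_edges_neq0 x; rewrite -e eqxx.
Qed.

Lemma vertices_walk_edges x u : u \in vertices (walk_edges x) -> exists2 n, n < k & walk x n = u.
Proof.
move=> /cover_cycle_edges /mapP[n]; rewrite mem_iota => nk ->.
by exists n.
Qed.

Let full_class i := [set walk_edges (inl (i, j)) | j : J].
Let half_class := [set walk_edges (inr h) | h : H].

Lemma class_disjoint i : vertex_disjoint (full_class i).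
Proof.
move=> _ _ /imsetP[j _ ->] /imsetP[j' _ ->] ne; apply/pred0P => u /=.
apply/negP => /andP[/vertices_walk_edges[n nk e] /vertices_walk_edges[n' n'k e']].
have e2 : walk (inl (i, j)) n = walk (inl (i, j')) n' := etrans e (esym e').
have [ej _] := @class_inj i (j, Ordinal nk) (j', Ordinal n'k) e2.
by rewrite ej eqxx in ne.
Qed.

Lemma half_class_disjoint : vertex_disjoint half_class.
Proof.
move=> _ _ /imsetP[h _ ->] /imsetP[h' _ ->] ne; apply/pred0P => u /=.
apply/negP => /andP[/vertices_walk_edges[n nk e] /vertices_walk_edges[n' n'k e']].
have e2 : half h n = half h' n' := etrans e (esym e').
by have [eh _] := half_inj cov nk n'k e2; rewrite eh eqxx in ne.
Qed.

Lemma card_class i : #|full_class i| = v.-1 %/ k.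
Proof.
rewrite card_imset => [|j j' /walk_edges_inj[->] //]; rewrite cardJ /v addn1 /=.
by rewrite mulnAC mulnK //; apply: ltnW (ltnW k2).
Qed.

Lemma card_half_class : #|half_class| = v.-1 %/ (2 * k).
Proof.
rewrite card_imset => [|h h' /walk_edges_inj[->] //]; rewrite cardH /v addn1 /=.
by rewrite mulKn // muln_gt0 /=; apply: ltnW (ltnW k2).
Qed.

Lemma ARCS_of_ordinal_covering : ARCS k system.
Proof.
have k0 : 0 < k by apply: ltnW (ltnW k2).
have J0 : 0 < #|J| by rewrite cardJ; lia.
have [j0 _] := eq_bigmax (fun=> 0) J0.
have H0 : 0 < #|H| by rewrite cardH.
have [h0 _] := eq_bigmax (fun=> 0) H0.
have full_sub i : full_class i \subset system by apply/subsetP => _ /imsetP[j _ ->]; apply: imset_f.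
have half_sub : half_class \subset system by apply/subsetP => _ /imsetP[h _ ->]; apply: imset_f.
have full_inj : injective full_class.
  move=> i i' e; have : walk_edges (inl (i, j0)) \in full_class i' by rewrite -e; apply: imset_f.
  by move=> /imsetP[j _ /walk_edges_inj[]].
have half_neq_full i : half_class != full_class i.
  apply/eqP => e; have : walk_edges (inr h0) \in full_class i by rewrite -e; apply: imset_f.
  by move=> /imsetP[j _ /walk_edges_inj].
split.
- by rewrite /v [2 * k * t]mulnC modnMDl.
- split; last exact: partition_system.
  move=> _ /imsetP[x _ ->]; split=> //; exists (mkseq (walk x) k).
  by rewrite size_mkseq walk_uniq.
exists [set full_class i | i : I], half_class; split.
- by rewrite card_imset // cardI /v addn1 /= -mulnA mulKn.
- by move=> _ /imsetP[i _ ->]; split; [exact: full_sub|exact: card_class|exact: class_disjoint].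
- by split; [exact: half_sub|exact: card_half_class|exact: half_class_disjoint].
- by apply/imsetP => -[i _ e]; have := half_neq_full i; rewrite e eqxx.
apply/and3P; split.
- rewrite eqEsubset; apply/andP; split.
    by apply/bigcupsP => C /setU1P[->|/imsetP[i _ ->]].
  apply/subsetP => _ /imsetP[[[i j]|h] _ ->]; apply/bigcupP.
  + by exists (full_class i); [rewrite setU1r ?imset_f|apply: imset_f].
  + by exists half_class; [rewrite setU11|apply: imset_f].
- apply/trivIsetP => A B; rewrite !inE.
  have disjoint_full_half i : [disjoint full_class i & half_class].
    apply/pred0P => C /=; apply/negP => /andP[/imsetP[j _ ->] /imsetP[h _]].
    by move=> /walk_edges_inj.
  move=> /orP[/eqP->|/imsetP[i _ ->]] /orP[/eqP->|/imsetP[i' _ ->]].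
  + by rewrite eqxx.
  + by rewrite disjoint_sym.
  + by [].
  + move=> ne; apply/pred0P => C /=; apply/negP => /andP[/imsetP[j _ ->] /imsetP[j' _]].
    by move=> /walk_edges_inj[ei _]; rewrite ei eqxx in ne.
- rewrite !inE negb_or; apply/andP; split.
    by apply/eqP => e; have : walk_edges (inr h0) \in half_class; [apply: imset_f | rewrite -e inE].
  apply/imsetP => -[i _ e].
  by have : walk_edges (inl (i, j0)) \in full_class i; [apply: imset_f | rewrite -e inE].
Qed.

End Counting.

(** The construction principle used below: vertices may be named by any finite
type, and only coverage has to be proved. *)
Lemma ARCS_of_covering k t (T I J H : finType)
    (cyc : I -> J -> nat -> T) (half : H -> nat -> T) :
  2 < k -> 0 < t -> #|T| = 2 * k * t + 1 ->
  #|I| = k * t -> #|J| = 2 * t -> #|H| = t ->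
  arcs_covering k cyc half ->
  exists S : {set subgraph (2 * k * t + 1)}, ARCS k S.
Proof.
move=> k2 t0 cT cI cJ cH cov.
pose rank x := cast_ord cT (enum_rank x).
pose pt i : T := enum_val (cast_ord (esym cT) i).
have rankK : cancel rank pt by move=> x; rewrite /pt cast_ordK enum_rankK.
have ptK : cancel pt rank by move=> x; rewrite /rank enum_valK cast_ordKV.
have cov' := arcs_covering_transport rankK ptK cov.
by eexists; exact: (ARCS_of_ordinal_covering k2 t0 cI cJ cH cov').
Qed.

Lemma joinsC T k (c : nat -> T) x y : joins k c x y -> joins k c y x.
Proof. by case=> n nk [[? ?]|[? ?]]; exists n => //; [right | left]. Qed.

(** * The zigzag through the residues modulo an odd number *)

Section OddResidues.

Variable h : nat.
Hypothesis h_gt0 : 0 < h.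
Local Notation m := h.*2.+1.

Lemma m_gt1 : 1 < m. Proof. lia. Qed.

Lemma Zm_nat0 n : ((n + m)%:R = n%:R :> 'Z_m)%R.
Proof. by rewrite natrD pchar_Zp ?m_gt1 // addr0. Qed.

Lemma Zm_natB n : n <= m -> ((m - n)%:R = - n%:R :> 'Z_m)%R.
Proof. by move=> nm; rewrite natrB // pchar_Zp ?m_gt1 // sub0r. Qed.

Lemma val_Zm_lt (r : 'Z_m) : (r < m)%N.
Proof. by have := ltn_ord r; rewrite [X in (_ < X)%N]Zp_cast ?m_gt1. Qed.

Lemma Zm_nat_inj n n' : n < m -> n' < m -> (n%:R = n'%:R :> 'Z_m)%R -> n = n'.
Proof.
by move=> nm n'm /(congr1 (@nat_of_ord _)); rewrite !val_Zp_nat ?m_gt1 // !modn_small.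
Qed.

Definition Zhalf : 'Z_m := (h.+1%:R)%R.

Lemma Zhalf2 : (Zhalf + Zhalf = 1)%R.
Proof. by rewrite /Zhalf -natrD (_ : h.+1 + h.+1 = 1 + m) ?Zm_nat0 //; lia. Qed.

(** The sequence 0, 1, -1, 2, -2, ..., whose first [m] terms are all the residues. *)
Definition zigzag n : 'Z_m :=
  (if odd n then n./2.+1%:R else - n./2%:R)%R.

(** Step [n] has difference [n] if [n] is odd and [- n] if it is even. As [m] is odd,
steps [n] and [m - n] have opposite parities, hence the same difference. *)
Lemma zigzagS n :
  (zigzag n.+1 = zigzag n + (if odd n then - n.+1%:R else n.+1%:R))%R.
Proof.
rewrite -(odd_double_half n) /zigzag; move: n./2 => a.
case: (odd n); rewrite ?add1n ?add0n /= !odd_double /= ?doubleK ?uphalf_double.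
  have -> : a.*2.+2 = a.+1 + a.+1 by lia.
  by rewrite natrD; ring.
have -> : a.*2.+1 = a.+1 + a by lia.
by rewrite natrD; ring.
Qed.

Lemma zigzag_surj r : exists2 n, n < m & zigzag n = r.
Proof.
rewrite -[r]natr_Zp; have := val_Zm_lt r; move: (val r) => a am.
have [a0|a0] := posnP a; first by exists 0 => //; rewrite /zigzag a0 /= oppr0.
have [ah|ha] := leqP a h.
  exists a.*2.-1; first lia.
  have -> : a.*2.-1 = a.-1.*2.+1 by lia.
  by rewrite /zigzag /= odd_double /= uphalf_double prednK.
exists (m - a).*2; first lia.
by rewrite /zigzag odd_double doubleK Zm_natB ?opprK 1?ltnW.
Qed.

End OddResidues.

(** * Classes made of labelled zigzags *)

Section LatinZigzag.

Variable h : nat.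
Hypothesis h_gt0 : 0 < h.
Local Notation m := h.*2.+1.

(** The vertices are the pairs of a residue and a label in [L], and a point at
infinity [None]. A base class [c] consists of zigzag passes, one for each label
[l], which starts at the vertex (0, l); its labels change from step to step by
permutations of [L]: [tau1 c] at the first step, [tau2 c] at the last one, and
the translations by [u c] and [v c] at the other odd and even steps. The passes
of [l] and [iota c l] are linked at both ends into a cycle of length [2 m], and
the starting point with label [s c] is replaced by infinity. The classes are the
translates of the base classes by residues. *)
Variables (L : zmodType) (C J H : Type).
Variables (s u v d : C -> L) (tau1 tau2 iota : C -> L -> L).
Variables (rep : C -> J -> L) (hl : H -> L * L).

(* [rep c] picks one pass of each cycle, [d c] is the label difference between
   the two passes of a cycle between the first and the last step. *)
Hypothesis iotaK : forall c, involutive (iota c).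
Hypothesis iota_neq : forall c l, iota c l <> l.
Hypothesis repP : forall c l, exists j, l = rep c j \/ l = iota c (rep c j).
Hypothesis tau1_surj : forall c q, exists p, tau1 c p = q.
Hypothesis tau2_surj : forall c q, exists p, tau2 c p = q.
Hypothesis tau1_iota : forall c l, tau1 c (iota c l) = (tau1 c l + d c)%R.
(* The difference 1 occurs at the steps 1 and [m - 1] of each base class, and an
   odd difference [n > 1] at the inner steps [n] and [m - n]: in both cases the
   label permutations met there must form a Latin square. *)
Hypothesis outer_latin : forall p q, exists c, tau1 c p = q \/ tau2 c p = q.
Hypothesis inner_latin : forall p q, exists c, q = (p + u c)%R \/ q = (p + v c)%R.
(* Edges between equal residues come from the links at the start (except the one
   at the missing vertex) and at the end of the passes. *)
Hypothesis links : forall p q, p <> q ->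
  (exists c, [/\ q = iota c p, p <> s c & q <> s c]) \/
  (exists c p', p = tau2 c p' /\ q = tau2 c (p' + d c)%R).
Hypothesis apex : forall p, exists c, p = iota c (s c) \/ p = tau1 c (s c).
(* Putting infinity in place of (0, s c) removes the edge from there to
   (1, tau1 c (s c)); the half-parallel class is made of the edges so lost. *)
Hypothesis hl_lost : forall c, exists x,
  hl x = (s c, tau1 c (s c)) \/ hl x = (tau1 c (s c), s c).
Hypothesis hl1_inj : injective (fun x => (hl x).1).
Hypothesis hl2_inj : injective (fun x => (hl x).2).
Hypothesis hl_neq : forall x x', (hl x).1 <> (hl x').2.

Definition step c n (x : L) : L :=
  if n == 1 then tau1 c x else if n == h.*2 then tau2 c x
  else (x + (if odd n then u c else v c))%R.

Fixpoint label c n (l : L) : L :=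
  if n is n'.+1 then step c n (label c n' l) else l.

Definition stop c (z : 'Z_m) n l : option ('Z_m * L) :=
  if (n == 0) && (l == s c) then None else Some ((zigzag h n + z)%R, label c n l).

Definition latin_cycle (i : C * 'Z_m) j n : option ('Z_m * L) :=
  if n < m then stop i.1 i.2 n (rep i.1 j)
  else stop i.1 i.2 ((2 * m).-1 - n) (iota i.1 (rep i.1 j)).

Definition half_cycle x n : 'Z_m * L :=
  (n%:R%R, if odd n then (hl x).2 else (hl x).1).

Lemma step_inner c n x : 1 < n < h.*2 ->
  step c n x = (x + (if odd n then u c else v c))%R.
Proof. by move=> nh; rewrite /step; do 2 (case: eqP => [?|_]; first lia). Qed.

Lemma step_last c x : step c h.*2 x = tau2 c x.
Proof. by rewrite /step eqxx; case: eqP => //; lia. Qed.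

Lemma labelS c n l : label c n.+1 l = step c n.+1 (label c n l).
Proof. by []. Qed.

Lemma label_surj c n p : exists l, label c n l = p.
Proof.
elim: n p => [|n IH] p /=; first by exists p.
rewrite /step; case: eqP => _.
  by have [q <-] := tau1_surj c p; have [l <-] := IH q; exists l.
case: eqP => _.
  by have [q <-] := tau2_surj c p; have [l <-] := IH q; exists l.
set w := (if _ then _ else _); have [l e] := IH (p - w)%R.
by exists l; rewrite e subrK.
Qed.

(** Translations do not change the difference of two labels. This is why the end of
the passes looks the same whatever the number of inner steps is, so that one
choice of [tau1] and [tau2] serves all odd [m]. *)
Lemma label_iota c n l : 0 < n < h.*2 -> label c n (iota c l) = (label c n l + d c)%R.
Proof.
case: n => // n; elim: n => [|n IH] nh; first by rewrite /= /step /= tau1_iota.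
rewrite [LHS]labelS [in RHS]labelS IH; last lia.
by rewrite !step_inner // addrAC.
Qed.

Lemma stop_in c z n l : n < m ->
  exists j n', n' < 2 * m /\ latin_cycle (c, z) j n' = stop c z n l.
Proof.
move=> nm; have [j [e|e]] := repP c l.
  by exists j, n; rewrite /latin_cycle /= nm -e; split=> //; lia.
exists j, ((2 * m).-1 - n); rewrite /latin_cycle /= -e ifF; last lia.
by split; [lia|congr stop; lia].
Qed.

Lemma joins_step c z n l : n.+1 < m ->
  exists j, joins (2 * m) (latin_cycle (c, z) j) (stop c z n l) (stop c z n.+1 l).
Proof.
move=> nm; have [j [e|e]] := repP c l; exists j.
  exists n; first lia.
  by left; rewrite modn_small /latin_cycle /= -?e ?ifT //; lia.
exists ((2 * m).-1 - n.+1); first lia.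
right; rewrite modn_small; last lia.
by rewrite /latin_cycle /= -e !ifF; [split; congr stop; lia|lia..].
Qed.

Lemma joins_near c z l :
  exists j, joins (2 * m) (latin_cycle (c, z) j) (stop c z 0 l) (stop c z 0 (iota c l)).
Proof.
have [j jP] := repP c l; exists j.
suff J1 : joins (2 * m) (latin_cycle (c, z) j)
    (stop c z 0 (iota c (rep c j))) (stop c z 0 (rep c j)).
  by case: jP => ->; rewrite ?iotaK //; apply: joinsC.
exists (2 * m).-1; first lia.
left; rewrite prednK ?modnn; last lia.
by rewrite /latin_cycle ifF ?subnn //=; lia.
Qed.

Lemma joins_far c z l :
  exists j, joins (2 * m) (latin_cycle (c, z) j)
    (stop c z h.*2 l) (stop c z h.*2 (iota c l)).
Proof.
have [j jP] := repP c l; exists j.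
suff J1 : joins (2 * m) (latin_cycle (c, z) j)
    (stop c z h.*2 (rep c j)) (stop c z h.*2 (iota c (rep c j))).
  by case: jP => ->; rewrite ?iotaK //; apply: joinsC.
exists h.*2; first lia.
left; rewrite modn_small; last lia.
rewrite /latin_cycle ifT // ifF /=; last lia.
by split=> //; congr stop; lia.
Qed.

Local Notation covered x y :=
  ((exists i, exists j, joins (2 * m) (latin_cycle i j) x y) \/
   (exists x0, joins (2 * m) (fun n => Some (half_cycle x0 n)) x y)).

Lemma stop_pos c z n l : 0 < n -> stop c z n l = Some ((zigzag h n + z)%R, label c n l).
Proof. by rewrite /stop; case: n. Qed.

Lemma covered_step c n r p : 1 < n < m ->
  covered (Some (r, p))
    (Some ((r + (if odd n then n%:R else - n%:R))%R, step c n p)).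
Proof.
case: n => // n /andP[n0 nm]; left; have [l e] := label_surj c n p.
exists (c, (r - zigzag h n)%R).
have [j Jj] := joins_step c (r - zigzag h n)%R l nm; exists j.
move: Jj; rewrite !stop_pos // labelS e (zigzagS h_gt0) oddS if_neg.
have e1 : (zigzag h n + (r - zigzag h n) = r)%R by rewrite addrC subrK.
by rewrite addrAC e1.
Qed.

(** A half cycle alternates its two labels while its residue increases by 1. Since [m]
is odd, it meets every residue with both labels before it closes. *)
Lemma covered_half c r : covered (Some (r, s c)) (Some ((r + 1)%R, tau1 c (s c))).
Proof.
right; have [x hx] := hl_lost c; exists x.
have rm := val_Zm_lt h_gt0 r; rewrite -[r]natr_Zp.
pose b := if hl x == (s c, tau1 c (s c)) then false else true.
pose n := if odd r == b then nat_of_ord r else r + m.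
have odd_n : odd n = b.
  rewrite /n; case: eqP => [//|]; rewrite oddD oddS odd_double.
  by case: (odd r) (b) => -[].
have nR : (n%:R = (nat_of_ord r)%:R :> 'Z_m)%R.
  by rewrite /n; case: ifP => // _; rewrite Zm_nat0.
have nlt : n < 2 * m by rewrite /n; case: ifP; lia.
clearbody n; exists n => //; left; rewrite /half_cycle nR odd_n; split.
  by congr (Some (_, _)); rewrite /b; case: eqP => [->//|]; case: hx => ->.
have -> : odd (n.+1 %% (2 * m)) = ~~ b.
  rewrite -odd_n; case: (ltngtP n.+1 (2 * m)) nlt => // [lt|e] _.
    by rewrite modn_small.
  by rewrite e modnn; lia.
have -> : ((n.+1 %% (2 * m))%:R = (nat_of_ord r)%:R + 1 :> 'Z_m)%R.
  rewrite -nR natr1; case: (ltngtP n.+1 (2 * m)) nlt => // [lt|->] _.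
    by rewrite modn_small.
  by rewrite modnn (_ : 2 * m = 0 + m + m) ?Zm_nat0 //; lia.
by congr (Some (_, _)); rewrite /b; case: eqP => [->//|]; case: hx => ->.
Qed.

Lemma covered_sym x y : covered x y -> covered y x.
Proof.
by case=> [[i [j e]]|[x0 e]]; [left; exists i, j|right; exists x0]; apply: joinsC.
Qed.

(** Odd [n] suffices for all nonzero differences, as [n] and [- n] describe the same
edges and one of the numbers [n] and [m - n] is odd. *)
Lemma covered_odd n r p q : odd n -> n < m ->
  covered (Some (r, p)) (Some ((r + n%:R)%R, q)).
Proof.
move=> on nm; have [n1|n1] := eqVneq n 1.
  rewrite n1; have [c [e|e]] := outer_latin p q.
    have [ps|ps] := eqVneq p (s c); first by rewrite -e ps; apply: covered_half.
    left; exists (c, r); have [|j Jj] := joins_step c r p (_ : 1 < m); first lia.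
    exists j; move: Jj; rewrite /stop (negbTE ps) /= /step /= e /zigzag /=.
    by rewrite oppr0 add0r addrC.
  have := @covered_step c h.*2 r p _; rewrite step_last e odd_double.
  by rewrite -(Zm_natB h_gt0) ?subSnn //; apply; lia.
have [c [->|->]] := inner_latin p q.
  have := @covered_step c n r p _; rewrite step_inner; last lia.
  by rewrite on; apply; lia.
have := @covered_step c (m - n) r p _; rewrite step_inner; last lia.
have -> : odd (m - n) = false by lia.
by rewrite Zm_natB ?opprK; [apply; lia|lia..].
Qed.

Lemma covered_link r p q : p <> q -> covered (Some (r, p)) (Some (r, q)).
Proof.
move=> pq; case: (links pq) => [[c [e ps qs]]|[c [p' [-> ->]]]]; left.
  exists (c, r); have [j Jj] := joins_near c r p; exists j; move: Jj.
  move/eqP/negbTE: ps qs => ps /eqP/negbTE qs.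
  by rewrite /stop -e ps qs /= /zigzag /= oppr0 add0r.
have [l e] := label_surj c h.*2.-1 p'.
exists (c, (r - zigzag h h.*2)%R).
have [j Jj] := joins_far c (r - zigzag h h.*2)%R l; exists j; move: Jj.
have er : (zigzag h h.*2 + (r - zigzag h h.*2) = r)%R by rewrite addrC subrK.
rewrite !stop_pos ?double_gt0 // er.
have lE l' : label c h.*2 l' = tau2 c (label c h.*2.-1 l').
  by rewrite -{1}(@prednK h.*2) ?double_gt0 // labelS prednK ?double_gt0 // step_last.
by rewrite !lE label_iota ?e //; lia.
Qed.

Lemma covered_apex r p : covered None (Some (r, p)).
Proof.
left; have [c [e|e]] := apex p.
  exists (c, r); have [j Jj] := joins_near c r (s c); exists j; move: Jj.
  have /eqP/negbTE ps := @iota_neq c (s c).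
  by rewrite /stop !eqxx ps /= -e /zigzag /= oppr0 add0r.
exists (c, (r - zigzag h 1)%R).
have [|j Jj] := joins_step c (r - zigzag h 1)%R (s c) (_ : 1 < m); first lia.
have er : (zigzag h 1 + (r - zigzag h 1) = r)%R by rewrite addrC subrK.
by exists j; move: Jj; rewrite /stop !eqxx /= /step /= -e er.
Qed.

Theorem latin_zigzag_covering :
  arcs_covering (2 * m) latin_cycle (fun x n => Some (half_cycle x n)).
Proof.
split.
- case=> c z; exists (Some (z, s c)) => -[[r p]|] ne; last first.
    have [|j [n [nm e]]] := @stop_in c z 0 (s c) _; first lia.
    by exists j, n => //; rewrite e /stop !eqxx.
  have [n nm e] := zigzag_surj h_gt0 (r - z)%R.
  have [l el] := label_surj c n p.
  have [j [n' [n'm e']]] := @stop_in c z n l nm.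
  exists j, n' => //; rewrite e' /stop; case: ifP => [/andP[/eqP n0 /eqP ls]|_].
    case: ne; rewrite -el n0 /= ls; congr (Some (_, _)).
    by move: e; rewrite n0 /zigzag /= oppr0 => /esym/eqP; rewrite subr_eq0 => /eqP.
  by rewrite e subrK el.
- move=> x x' n n' nm n'm [en el].
  have nE : n %% m = n' %% m.
    by move/(congr1 (@nat_of_ord _)): en; rewrite !val_Zp_nat ?m_gt1.
  have ex : odd n = odd n' /\ x = x'.
    move: el; case: (odd n); case: (odd n').
    + by move=> /hl2_inj.
    + by move=> /esym/hl_neq.
    + by move=> /hl_neq.
    + by move=> /hl1_inj.
  case: ex => on ->; split=> //.
  have q2 : n %/ m < 2 by rewrite ltn_divLR.
  have q2' : n' %/ m < 2 by rewrite ltn_divLR.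
  have oq : odd (n %/ m) = odd (n' %/ m).
    move: on; rewrite {1}(divn_eq n m) {1}(divn_eq n' m) nE !oddD !oddM /=.
    by rewrite !odd_double !andbT => /addIb.
  have eq_q : n %/ m = n' %/ m.
    by case: (n %/ m) (n' %/ m) q2 q2' oq => [|[|?]] [|[|?]].
  by rewrite (divn_eq n m) eq_q nE -divn_eq.
- move=> [[r p]|] [[r' q]|] ne //;
    [|by apply: covered_sym; apply: covered_apex|exact: covered_apex].
  have [er|nr] := eqVneq r r'.
    by subst r'; apply: covered_link => e; apply: ne; rewrite e.
  have rm := val_Zm_lt h_gt0 (r' - r)%R.
  have er' : r' = (r + (nat_of_ord (r' - r))%:R)%R by rewrite natr_Zp addrC subrK.
  have r0 : nat_of_ord (r' - r)%R != 0.
    by apply: contra nr => /eqP e; rewrite er' e addr0.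
  have [o|e] := boolP (odd (nat_of_ord (r' - r)%R)); first by rewrite er'; apply: covered_odd.
  apply: covered_sym; have -> : r = (r' + (m - nat_of_ord (r' - r))%:R)%R.
    by rewrite Zm_natB ?natr_Zp ?(ltnW rm) //; ring.
  by apply: covered_odd; lia.
Qed.

End LatinZigzag.

Local Notation bit3 := (bool * bool * bool)%type.

(** * The orders 2k + 1 and 4k + 1 *)

Definition num2 (x : bit2) : nat := x.1.*2 + x.2.
Definition bits2 (n : nat) : bit2 := (odd n./2, odd n).
Definition num3 (x : bit3) : nat := (num2 x.1).*2 + x.2.
Definition bits3 (n : nat) : bit3 := (bits2 n./2, odd n).

Definition table2 (r : seq nat) (x : bit2) : bit2 := bits2 (nth 0 r (num2 x)).
Definition table3 (r : seq nat) (x : bit3) : bit3 := bits3 (nth 0 r (num3 x)).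

Ltac split_bools :=
  repeat match goal with
  | x : ?T |- _ =>
      let T' := eval hnf in T in
      match T' with
      | prod _ _ => destruct x
      | bool => destruct x
      | unit => destruct x
      end
  end.

Ltac exists_label tac :=
  solve [ exists tt; tac | exists false; tac | exists true; tac
        | exists (false, false); tac | exists (false, true); tac
        | exists (true, false); tac | exists (true, true); tac
        | exists (false, false, false); tac | exists (false, false, true); tac
        | exists (false, true, false); tac | exists (false, true, true); tac
        | exists (true, false, false); tac | exists (true, false, true); tac
        | exists (true, true, false); tac | exists (true, true, true); tac ].

Ltac by_cases :=
  rewrite /involutive /cancel /injective; intros; split_bools;
  first
  [ reflexivity | discriminate | congruence
  | exists_label reflexivity
  | exists_label ltac:(solve [left; reflexivity | right; reflexivity])
  | left; exists_label ltac:(solve [split; [reflexivity | discriminate | discriminate]])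
  | right; exists_label ltac:(exists_label ltac:(solve [split; reflexivity])) ].

(** Four labels and two base classes. The pairings of four labels are permuted by
[first1] and [last1] through the quotient of the symmetric group by its Klein
subgroup; the four permutations form a Latin square, the two pairings found at
the end of the passes are different, and the links at the start make up the
third pairing. *)
Definition missed1 (c : bool) : bit2 := bits2 (if c then 1 else 0).
Definition odd_shift1 (c : bool) : bit2 := bits2 (if c then 2 else 0).
Definition even_shift1 (c : bool) : bit2 := bits2 (if c then 3 else 1).
Definition pair_shift1 (c : bool) : bit2 := bits2 (if c then 2 else 1).
Definition first1 c := table2 (if c then [:: 3; 0; 1; 2] else [:: 1; 2; 0; 3]).
Definition last1 c := table2 (if c then [:: 2; 1; 3; 0] else [:: 0; 3; 2; 1]).
Definition partner1 (c : bool) := table2 [:: 2; 3; 0; 1].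
Definition rep1 (c j : bool) : bit2 := bits2 j.
Definition half_labels1 (x : unit) : bit2 * bit2 := (bits2 0, bits2 1).

Lemma latin_covering1 h : 0 < h ->
  arcs_covering (2 * h.*2.+1)
    (latin_cycle (h := h) missed1 odd_shift1 even_shift1 first1 last1 partner1 rep1)
    (fun x n => Some (half_cycle h half_labels1 x n)).
Proof.
move=> h0; apply: (@latin_zigzag_covering _ h0 _ _ _ _ _ _ _ pair_shift1) => //.
all: by_cases.
Qed.

(** Eight labels and four base classes. The 28 pairs of labels are decomposed into
four perfect matchings, met at the ends of the passes, and four matchings that
avoid a missed label and its partner, met at the starts. The rows [first2] and
[last2] of a Latin square of order 8 take each pairing [partner2] to the pairs with
a constant difference, and these to one of the perfect matchings. *)
Definition missed2 (c : bit2) : bit3 := bits3 (num2 c).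
Definition odd_shift2 (c : bit2) : bit3 := bits3 (num2 c).*2.
Definition even_shift2 (c : bit2) : bit3 := bits3 (num2 c).*2.+1.
Definition pair_shift2 (c : bit2) : bit3 := bits3 (nth 0 [:: 2; 5; 6; 1] (num2 c)).
Definition first2 (c : bit2) : bit3 -> bit3 := table3 (nth [::]
  [:: [:: 1; 5; 2; 4; 3; 6; 0; 7]; [:: 3; 0; 6; 1; 2; 5; 7; 4];
      [:: 6; 1; 3; 0; 4; 7; 5; 2]; [:: 5; 6; 7; 2; 0; 1; 4; 3]] (num2 c)).
Definition last2 (c : bit2) : bit3 -> bit3 := table3 (nth [::]
  [:: [:: 0; 4; 1; 3; 7; 2; 6; 5]; [:: 2; 7; 4; 6; 5; 3; 1; 0];
      [:: 4; 3; 5; 7; 6; 0; 2; 1]; [:: 7; 2; 0; 5; 1; 4; 3; 6]] (num2 c)).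
Definition partner2 (c : bit2) : bit3 -> bit3 := table3 (nth [::]
  [:: [:: 4; 7; 6; 5; 0; 3; 2; 1]; [:: 2; 5; 0; 7; 6; 1; 4; 3];
      [:: 3; 5; 6; 0; 7; 1; 2; 4]; [:: 6; 2; 1; 7; 5; 4; 0; 3]] (num2 c)).
Definition rep2 (c j : bit2) : bit3 := bits3 (nth 0 (nth [::]
  [:: [:: 0; 1; 2; 3]; [:: 0; 1; 3; 4]; [:: 0; 1; 2; 4]; [:: 0; 1; 3; 4]]
  (num2 c)) (num2 j)).
Definition half_labels2 (x : bool) : bit3 * bit3 := (bits3 x.*2, bits3 x.*2.+1).

Lemma latin_covering2 h : 0 < h ->
  arcs_covering (2 * h.*2.+1)
    (latin_cycle (h := h) missed2 odd_shift2 even_shift2 first2 last2 partner2 rep2)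
    (fun x n => Some (half_cycle h half_labels2 x n)).
Proof.
move=> h0; apply: (@latin_zigzag_covering _ h0 _ _ _ _ _ _ _ pair_shift2) => //.
all: by_cases.
Qed.

Ltac decide_nat :=
  repeat match goal with
  | |- context [leq ?x ?y] =>
      first [ have -> : leq x y = true by lia | have -> : leq x y = false by lia ]
  | |- context [?x == ?y] =>
      first [ have -> : (x == y) = true by lia | have -> : (x == y) = false by lia ]
  end.

(** * Cycles between two groups of vertices *)

Section Bipartite.

Variable h : nat.
Hypothesis h_gt0 : 0 < h.
Local Notation m := h.*2.+1.

(** Labels of four base cycles that alternate between a left and a right group. Those
with first index [false] together give all edges between the groups; those with
first index [true] give two complementary halves of them, one each. In the second
case the second bits are kept as simple as possible, see [left_in_half]. *)
Definition llabel (kd : bool * bool) (i : nat) : bit2 :=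
  match kd with
  | (false, false) => (h < i, false)
  | (false, true) => (h <= i, i == h)
  | (true, false) => (false, i == 0)
  | (true, true) => ((i == 0) || (h < i), i == 0)
  end.

Definition rlabel (kd : bool * bool) (i : nat) : bit2 :=
  match kd with
  | (false, false) => (i == h.*2, i == h.*2)
  | (false, true) => (false, true)
  | (true, false) => (h < i, i != h.*2)
  | (true, true) => (false, i == h.*2)
  end.

Variable G : eqType.
Implicit Types (l r x : G) (z a b : 'Z_m) (w p q : bit2).

(** The [i]-th left vertex has residue [z + i] and the [i]-th right one [z - 1 - i], so
that each residue is met once on both sides and the differences run through all
residues twice. *)
Definition bip l r kd z w n : G * ('Z_m * bit2) :=
  if odd n then (r, ((z - n./2.+1%:R)%R, (rlabel kd n./2 + w)%R))
  else (l, ((z + n./2%:R)%R, (llabel kd n./2 + w)%R)).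

Definition sum1 kd i : bit2 := (llabel kd i + rlabel kd i)%R.
Definition sum2 kd i : bit2 :=
  let j := (i + h) %% m in (llabel kd (j.+1 %% m) + rlabel kd j)%R.

(** The difference - 1 - 2 i occurs on the edge from the [i]-th left vertex to the
[i]-th right one, and on the edge from the [j]-th right vertex to the next left
one for j = i + h, since 2 h + 1 = 0. With two base cycles this gives four sums of
labels, and they have to be the four elements of the label group. *)
Lemma sums_cover t i e : i < m -> exists c, e = sum1 (t, c) i \/ e = sum2 (t, c) i.
Proof.
move=> im; rewrite /sum1 /sum2.
have [j1 j2] : (i + h) %% m = (if i <= h then i + h else i - h.+1) /\
    ((i + h) %% m).+1 %% m = (if i < h then i + h.+1 else i - h).
  have e1 : (i + h) %% m = (if i <= h then i + h else i - h.+1).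
    case: leqP => ih; first by rewrite modn_small; lia.
    by rewrite (_ : i + h = i - h.+1 + m) ?modnDr ?modn_small; lia.
  split=> //; rewrite e1; case: (ltngtP i h) => ih.
  - by rewrite modn_small; lia.
  - by rewrite modn_small; lia.
  - by rewrite ih addnn modnn subnn.
rewrite j2 j1 {j1 j2}.
have [i0|[i0|[i0|[i0|i0]]]] : i = 0 \/ (0 < i < h) \/ i = h \/ (h < i < h.*2) \/
  i = h.*2 by lia.
all: case: t; rewrite /llabel /rlabel; decide_nat; case: e => [[] []].
all: first [exists false; left; reflexivity | exists false; right; reflexivity
  | exists true; left; reflexivity | exists true; right; reflexivity].
Qed.

Lemma addKbits p q : (p + (p + q) = q)%R.
Proof. by case: p q => [[] []] [[] []]. Qed.

Lemma shift_bits (x y p q : bit2) : (p + q = x + y)%R -> (y + (x + p) = q)%R.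
Proof. by rewrite addrA [(y + x)%R]addrC => <-; rewrite [LHS]addrC addKbits. Qed.

Lemma joins_bip1 l r kd z w i : i < m ->
  joins (2 * m) (bip l r kd z w)
    (l, ((z + i%:R)%R, (llabel kd i + w)%R)) (r, ((z - i.+1%:R)%R, (rlabel kd i + w)%R)).
Proof.
move=> im; exists i.*2; first lia.
left; rewrite /bip odd_double doubleK modn_small; last lia.
by rewrite /= odd_double /= uphalf_double.
Qed.

Lemma joins_bip2 l r kd z w i : i < m ->
  joins (2 * m) (bip l r kd z w)
    (l, ((z + i.+1%:R)%R, (llabel kd (i.+1 %% m) + w)%R))
    (r, ((z - i.+1%:R)%R, (rlabel kd i + w)%R)).
Proof.
move=> im; exists i.*2.+1; first lia.
right; rewrite /bip /= odd_double /= uphalf_double; split=> //.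
have [ih|->] : i < h.*2 \/ i = h.*2 by lia.
  rewrite !modn_small; [|lia..].
  by rewrite /= odd_double /= doubleK.
rewrite modnn (_ : h.*2.*2.+2 = 2 * m); last lia.
by rewrite modnn /= [in RHS]pchar_Zp ?m_gt1.
Qed.

Lemma edge_cover t l r a b p q : exists c z w,
  joins (2 * m) (bip l r (t, c) z w) (l, (a, p)) (r, (b, q)).
Proof.
have half2 := Zhalf2 h_gt0; pose half := Zhalf h; rewrite -/half in half2.
pose i := nat_of_ord (- ((b - a + 1) * half) : 'Z_m)%R.
have im : i < m := val_Zm_lt h_gt0 _.
have iR : (i%:R = - ((b - a + 1) * half) :> 'Z_m)%R by rewrite natr_Zp.
have bE : (b = a - i%:R - i%:R - 1)%R.
  have -> : (a - i%:R - i%:R - 1 = a + (b - a + 1) * (half + half) - 1)%R.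
    by rewrite iR; ring.
  by rewrite half2; ring.
clearbody i; clear iR.
have [c [e|e]] := sums_cover t (p + q)%R im.
  exists c, (a - i%:R)%R, (llabel (t, c) i + p)%R.
  have := joins_bip1 l r (t, c) (a - i%:R)%R (llabel (t, c) i + p)%R im.
  have -> : (a - i%:R + i%:R = a)%R by ring.
  have -> : (a - i%:R - i.+1%:R = b)%R by rewrite bE -natr1; ring.
  by rewrite addKbits (shift_bits e).
pose j := (i + h) %% m; have jm : j < m by rewrite ltn_mod.
have jR : (j.+1%:R = i%:R + half :> 'Z_m)%R.
  by rewrite /half /Zhalf -natr1 Zp_nat_mod ?m_gt1 // !natrD -natr1; ring.
exists c, (a - j.+1%:R)%R, (llabel (t, c) (j.+1 %% m) + p)%R.
have := joins_bip2 l r (t, c) (a - j.+1%:R)%R (llabel (t, c) (j.+1 %% m) + p)%R jm.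
have -> : (a - j.+1%:R + j.+1%:R = a)%R by ring.
have -> : (a - j.+1%:R - j.+1%:R = b)%R.
  by rewrite bE jR -half2; ring.
by rewrite addKbits (shift_bits e).
Qed.

Lemma left_in l r kd a z p : exists2 n, n < 2 * m &
  bip l r kd z (llabel kd (a - z)%R + p)%R n = (l, (a, p)).
Proof.
have im := val_Zm_lt h_gt0 (a - z)%R; exists ((a - z)%R : nat).*2; first lia.
by rewrite /bip odd_double doubleK addKbits natr_Zp addrC subrK.
Qed.

Lemma right_in l r kd a z p : exists2 n, n < 2 * m &
  bip l r kd z (rlabel kd (z - a - 1)%R + p)%R n = (r, (a, p)).
Proof.
have -> : a = (z - (z - a - 1) - 1)%R by ring.
have -> : (z - (z - (z - a - 1) - 1) - 1 = z - a - 1)%R by ring.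
move: (z - a - 1)%R => i; have im := val_Zm_lt h_gt0 i; exists i.*2.+1; first lia.
rewrite /bip /= odd_double /= uphalf_double addKbits -natr1 natr_Zp.
by congr (_, (_, _)); ring.
Qed.

(** At a given residue, a cycle of a half and its translate by (true, false) occupy
the two labels with the same second bit. That bit is changed at a single residue
on both sides alike, so which bit is taken depends on the offset only, and the
left and right sides of both halves fit together group after group. *)
Lemma left_in_half l r c a z p : exists w1 : bool, exists2 n, n < 2 * m &
  bip l r (true, c) z (w1, (a == z) (+) p.2) n = (l, (a, p)).
Proof.
have := left_in l r (true, c) a z p; set w := (_ + p)%R.
have -> : w = (w.1, (a == z) (+) p.2); last by exists w.1.
rewrite {}/w -(subr_eq0 a z) -val_eqE /=.
by case: c p => [] [].
Qed.

Lemma right_in_half l r c a z p : exists w1 : bool, exists2 n, n < 2 * m &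
  bip l r (true, c) z (w1, (a == z) (+) ~~ c (+) p.2) n = (r, (a, p)).
Proof.
have := right_in l r (true, c) a z p; set w := (_ + p)%R.
have -> : w = (w.1, (a == z) (+) ~~ c (+) p.2); last by exists w.1.
have -> : (a == z) = (nat_of_ord (z - a - 1)%R == h.*2).
  have im := val_Zm_lt h_gt0 (z - a - 1)%R.
  have e : (h.*2%:R = - 1 :> 'Z_m)%R.
    by have := @Zm_natB h h_gt0 1 isT; rewrite subSS subn0.
  apply/eqP/eqP => [->|/(congr1 (fun n => n%:R%R : 'Z_m))].
    apply: (Zm_nat_inj h_gt0 (val_Zm_lt h_gt0 _)) => //.
    by rewrite natr_Zp e subrr sub0r.
  by rewrite natr_Zp e => /(canRL (addrK _))/eqP; rewrite subrr subr_eq0 => /eqP.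
rewrite {}/w /=; case: c p => [] [p1 p2] /=; case: (_ == _) => //.
Qed.

End Bipartite.

(** * From schemes on the groups to systems *)

Section Scheme.

Variable h : nat.
Hypothesis h_gt0 : 0 < h.
Local Notation m := h.*2.+1.

(** An arrow tells how two groups are joined in a class: by half of the edges between
them ([Some c] names the half), or by all of them ([None]); in the latter case
the pair has two arrows, with different offsets, and each carries half of the
cycles. For a half, the offset is the second label bit taken on the left. *)
Record arrow (G : Type) := Arrow {
  arrow_left : G; arrow_right : G; arrow_half : option bool; arrow_offset : bool
}.

(** [A g x] is the arrow contributed by the group [x] to the class that misses [g]. *)
Variables (G : finType) (A : G -> G -> arrow G).

(** A half takes on the right side the bit opposite to the one of the left side if
it is the first half, and the same bit if it is the second one. *)
Definition port (a : arrow G) x b : Prop := exists2 c, arrow_half a = Some c &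
  (x = arrow_left a /\ b = arrow_offset a) \/
  (x = arrow_right a /\ b = ~~ c (+) arrow_offset a).

(* A group is served by both arrows of a pair, or by two halves, one for each bit. *)
Hypothesis stations : forall g x, x != g ->
  (exists l r, (x = l \/ x = r) /\
    forall o, exists2 y, y != g & A g y = Arrow l r None o) \/
  (forall b, exists2 y, y != g & port (A g y) x b).

Hypothesis pairs : forall x y, x != y ->
  exists l r, ((l, r) = (x, y) \/ (l, r) = (y, x)) /\
    ((exists g, forall o, exists2 y', y' != g & A g y' = Arrow l r None o) \/
     (forall c, exists g o, exists2 y', y' != g & A g y' = Arrow l r (Some c) o)).

Definition frame_cycle g (f : bool * 'Z_m) x (q : bool) : nat -> G * ('Z_m * bit2) :=
  let a := A g x in
  if arrow_half a is Some c then
    bip (arrow_left a) (arrow_right a) (true, c) f.2 (q, f.1 (+) arrow_offset a)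
  else bip (arrow_left a) (arrow_right a) (false, f.1) f.2 (q, arrow_offset a).

Variables (cyc : bool * 'Z_m -> bool -> nat -> option ('Z_m * bit2)).
Variables (half : unit -> nat -> 'Z_m * bit2).
Hypothesis base : arcs_covering (2 * m) cyc (fun u n => Some (half u n)).

(** Each class of the arrows is completed by a class of a system on the missing group
together with infinity. *)
Definition assembled_cycle (i : G * (bool * 'Z_m)) (j : G * bool) n :
    option (G * ('Z_m * bit2)) :=
  if j.1 == i.1 then omap (pair j.1) (cyc i.2 j.2 n)
  else Some (frame_cycle i.1 i.2 j.1 j.2 n).

Definition assembled_half (g : G) n : option (G * ('Z_m * bit2)) :=
  Some (g, half tt n).

Lemma frame_vertex g f x p : x != g -> exists y q, y != g /\
  exists2 n, n < 2 * m & frame_cycle g f y q n = (x, p).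
Proof.
case: f p => [t z] [a p] xg; rewrite /frame_cycle.
case: (stations xg) => [[l [r [xlr Hw]]]|Hh].
  have [[w1 w2] Hn] : exists w, exists2 n, n < 2 * m & bip l r (false, t) z w n = (x, (a, p)).
    case: xlr => ->; first by eexists; apply: left_in.
    by eexists; apply: right_in.
  have [y yg ey] := Hw w2.
  by exists y, w1; rewrite ey.
have [y yg [c ec [[ex eo]|[ex eo]]]] := Hh ((a == z) (+) p.2 (+) t).
  have [w1 Hn] := left_in_half h_gt0 (arrow_left (A g y)) (arrow_right (A g y)) c a z p.
  exists y, w1; split=> //; rewrite ec -eo ex.
  by rewrite [t (+) _]addbC addbK.
have [w1 Hn] := right_in_half h_gt0 (arrow_left (A g y)) (arrow_right (A g y)) c a z p.
exists y, w1; split=> //; rewrite ec ex.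
suff -> : t (+) arrow_offset (A g y) = (a == z) (+) ~~ c (+) p.2 by [].
move: eo; case: (a == z) p.2 t c (arrow_offset _) {ec Hn} => [] [] [] [] [] //.
Qed.

Lemma frame_edge x y p q : x != y -> exists i j, j.1 != i.1 /\
  joins (2 * m) (frame_cycle i.1 i.2 j.1 j.2) (x, p) (y, q).
Proof.
move=> xy; have [l [r [lr HH]]] := pairs xy.
suff main p' q' : exists i j, j.1 != i.1 /\
    joins (2 * m) (frame_cycle i.1 i.2 j.1 j.2) (l, p') (r, q').
  case: lr => -[-> ->] in main *; first exact: main.
  by have [i [j [ij e]]] := main q p; exists i, j; split=> //; apply: joinsC.
case: p' q' => [a p'] [b q']; rewrite /frame_cycle.
case: HH => [[g Hw]|Hh].
  have [c [z [[w1 w2] e]]] := edge_cover h_gt0 false l r a b p' q'.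
  have [y' y'g ey] := Hw w2.
  by exists (g, (c, z)), (y', w1); rewrite /= ey.
have [c [z [[w1 w2] e]]] := edge_cover h_gt0 true l r a b p' q'.
have [g [o [y' y'g ey]]] := Hh c.
by exists (g, (w2 (+) o, z)), (y', w1); rewrite /= ey /= -addbA addbb addbF.
Qed.

Theorem scheme_covering :
  arcs_covering (2 * m) assembled_cycle assembled_half.
Proof.
split.
- case=> g f; have [m0 Hm] := class_covers base f.
  exists (omap (pair g) m0) => -[[x p]|] ne; last first.
    have [|j [n nm e]] := Hm None; first by move=> e; apply: ne; rewrite -e.
    by exists (g, j), n => //; rewrite /assembled_cycle /= eqxx e.
  have [e|xg] := eqVneq x g.
    have [|j [n nm en]] := Hm (Some p); first by move=> e'; apply: ne; rewrite -e' e.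
    by exists (g, j), n => //; rewrite /assembled_cycle /= eqxx en e.
  have [y [q [yg [n nm e]]]] := frame_vertex f p xg.
  by exists (y, q), n => //; rewrite /assembled_cycle /= (negbTE yg) e.
- move=> g g' n n' nm n'm [-> e]; split=> //.
  by have [] := @half_inj _ _ _ _ _ _ _ base tt tt n n' nm n'm; rewrite ?e.
have inner g a b : a <> b ->
    (exists i j, joins (2 * m) (assembled_cycle i j) (omap (pair g) a) (omap (pair g) b)) \/
    (exists g', joins (2 * m) (assembled_half g') (omap (pair g) a) (omap (pair g) b)).
  case/(edges_covered base) => [[f [j e]]|[[] e]].
    left; exists (g, f), (g, j); have := joins_map (omap (pair g)) e.
    by case=> n nm en; exists n => //; rewrite /assembled_cycle /= eqxx.
  by right; exists g; apply: (joins_map (omap (pair g)) e).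
move=> [[x p]|] [[y q]|] ne //.
- have [e|xy] := eqVneq x y.
    have pq : Some p <> Some q by case=> e'; apply: ne; rewrite e e'.
    by subst y; have := inner x _ _ pq.
  have [i [j [ij e]]] := frame_edge p q xy.
  left; exists i, j; have [n nm en] := joins_map Some e.
  by exists n => //; rewrite /assembled_cycle (negbTE ij).
- by have := inner x (Some p) None; apply.
- by have := inner y None (Some q); apply.
Qed.

End Scheme.

(** * Schemes *)

Definition scheme (G : finType) (A : G -> G -> arrow G) : Prop :=
  (forall g x, x != g ->
    (exists l r, (x = l \/ x = r) /\
      forall o, exists2 y, y != g & A g y = Arrow l r None o) \/
    (forall b, exists2 y, y != g & port (A g y) x b)) /\
  (forall x y, x != y ->
    exists l r, ((l, r) = (x, y) \/ (l, r) = (y, x)) /\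
      ((exists g, forall o, exists2 y', y' != g & A g y' = Arrow l r None o) \/
       (forall c, exists g o, exists2 y', y' != g & A g y' = Arrow l r (Some c) o))).

Lemma ARCS_of_scheme h (G : finType) (A : G -> G -> arrow G) : 0 < h -> 0 < #|G| ->
  scheme A ->
  exists S : {set subgraph (2 * (2 * h.*2.+1) * #|G| + 1)}, ARCS (2 * h.*2.+1) S.
Proof.
move=> h0 G0 [stations pairs].
have cZ : #|{: 'Z_h.*2.+1}| = h.*2.+1 by rewrite card_ord Zp_cast; lia.
apply: (ARCS_of_covering _ _ _ _ _ _ (scheme_covering h0 stations pairs (latin_covering1 h0))).
- lia.
- by [].
- by rewrite card_option !card_prod cZ card_bool; lia.
- by rewrite !card_prod cZ card_bool; lia.
- by rewrite card_prod card_bool mulnC.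
- by [].
Qed.

Lemma ARCS_order2 h : 0 < h ->
  exists S : {set subgraph (2 * (2 * h.*2.+1) * 2 + 1)}, ARCS (2 * h.*2.+1) S.
Proof.
move=> h0.
have cZ : #|{: 'Z_h.*2.+1}| = h.*2.+1 by rewrite card_ord Zp_cast; lia.
apply: (ARCS_of_covering _ _ _ _ _ _ (latin_covering2 h0)).
- lia.
- by [].
- by rewrite card_option !card_prod cZ card_bool; lia.
- by rewrite !card_prod cZ card_bool; lia.
- by rewrite card_prod card_bool.
- by rewrite card_bool.
Qed.

Lemma scheme_unit : scheme (fun g x : unit => Arrow x x None false).
Proof. by split=> [[] []|[] []]. Qed.

(** In the four triangles on the points 0, 1, 2, 3 each pair occurs twice; the table
assigns it the first half in one triangle and the second half in the other, with
an even number of second halves in every triangle, since the label bit changes at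
each second half and has to be the same after a turn. *)
Definition arrow4 (g x : bit2) : arrow bit2 :=
  let a l r c o := Arrow (bits2 l) (bits2 r) (Some c) o in
  nth (Arrow x x None false) (nth [::]
    [:: [:: a 0 0 false false; a 1 2 true false; a 2 3 true true; a 1 3 false true];
        [:: a 0 3 true true; a 0 0 false false; a 2 0 true false; a 2 3 false true];
        [:: a 0 1 true false; a 1 3 true true; a 0 0 false false; a 0 3 false true];
        [:: a 0 1 false false; a 1 2 false false; a 2 0 false false; a 0 0 false false]]
    (num2 g)) (num2 x).

Definition sides4 : seq (bit2 * bit2) :=
  [seq (bits2 p.1, bits2 p.2) | p <- [:: (0, 1); (1, 2); (2, 0); (0, 3); (1, 3); (2, 3)]].

Ltac exists_point tac :=
  first [ exists (false, false); tac | exists (false, true); tac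
        | exists (true, false); tac | exists (true, true); tac ].

Lemma scheme4 : scheme arrow4.
Proof.
split.
- move=> [[] []] [[] []] // _; right=> -[];
  exists_point ltac:(solve [reflexivity | eexists; [reflexivity |
     solve [left; split; reflexivity | right; split; reflexivity]]]).
- have main (x y : bit2) : (x, y) \in sides4 ->
    forall c, exists g o, exists2 y', y' != g & arrow4 g y' = Arrow x y (Some c) o.
    rewrite !inE; move: x y => [[] []] [[] []] // _ [];
    exists_point ltac:(solve
      [ exists true; exists_point ltac:(solve [reflexivity])
      | exists false; exists_point ltac:(solve [reflexivity]) ]).
  move=> x y xy; have [xyin|yxin] : (x, y) \in sides4 \/ (y, x) \in sides4.
    by move: x y xy => [[] []] [[] []] // _; (by left) || (by right).
  - by exists x, y; split; [left|right; apply: main].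
  - by exists y, x; split; [right|right; apply: main].
Qed.

Section OddScheme.

Variable e : nat.
Hypothesis e_gt0 : 0 < e.
Local Notation n := e.*2.+1.
Implicit Types g x y : 'Z_n.

(** Reflection in the centre [g] pairs the other residues. The order of the residues
decides which one is on the left. *)
Definition mirror_arrow (G : Type) (f : 'Z_n -> G) g x : arrow G :=
  let y := (g + g - x)%R in
  if (x < y)%N then Arrow (f x) (f y) None false else Arrow (f y) (f x) None true.

Lemma Zhalf_double x : ((x + x) * Zhalf e = x)%R.
Proof. by rewrite mulrDl -mulrDr Zhalf2 // mulr1. Qed.

Lemma double_inj x y : (x + x = y + y)%R -> x = y.
Proof. by move=> xy; rewrite -[x]Zhalf_double xy Zhalf_double. Qed.

Lemma mirror_pair (G : finType) (A : G -> G -> arrow G) (f : 'Z_n -> G) c g x y :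
    x != y -> (x + y = g + g)%R -> f x != c -> f y != c ->
    A c (f x) = mirror_arrow f g x -> A c (f y) = mirror_arrow f g y ->
  exists l r, ((l, r) = (f x, f y) \/ (l, r) = (f y, f x)) /\
    forall o, exists2 z, z != c & A c z = Arrow l r None o.
Proof.
move=> xy e2 xc yc; have [yE xE] : (g + g - x = y)%R /\ (g + g - y = x)%R.
  by rewrite -e2 [(x + y - x)%R]addrAC subrr add0r addrK.
rewrite /mirror_arrow yE xE; have [lt|lt|eq] := ltngtP x y => ex ey.
- by exists (f x), (f y); split=> [|[]]; [left | exists (f y) | exists (f x)].
- by exists (f y), (f x); split=> [|[]]; [right | exists (f x) | exists (f y)].
- by rewrite (ord_inj eq) eqxx in xy.
Qed.

Lemma reflect_sum g x : (x + (g + g - x) = g + g)%R.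
Proof. by rewrite addrC subrK. Qed.

Lemma reflect_neq g x : x != g -> x != (g + g - x)%R.
Proof.
apply: contra => /eqP e1; apply/eqP/double_inj.
by rewrite {2}e1 reflect_sum.
Qed.

Lemma midpoint x y : (x + y = (x + y) * Zhalf e + (x + y) * Zhalf e)%R.
Proof. by rewrite -mulrDr Zhalf2 // mulr1. Qed.

Lemma sum_center_neq g x y : x != y -> (x + y = g + g)%R -> x != g.
Proof.
move=> xy e1; apply: contra xy => /eqP xg.
by rewrite xg in e1 *; rewrite (addrI _ e1).
Qed.

Lemma scheme_odd : scheme (mirror_arrow id).
Proof.
split=> [g x xg|x y xy].
  have xy := reflect_neq xg; have e1 := reflect_sum g x.
  have yg : (g + g - x)%R != g.
    by apply: (@sum_center_neq _ _ x); rewrite 1?eq_sym // addrC.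
  have [l [r [lr HA]]] :=
    @mirror_pair _ (mirror_arrow id) id _ _ _ _ xy e1 xg yg erefl erefl.
  by left; exists l, r; split=> //; case: lr => -[-> ->]; auto.
have e1 := midpoint x y; have xg := sum_center_neq xy e1.
have yg : y != ((x + y) * Zhalf e)%R.
  by apply: (@sum_center_neq _ _ x); rewrite 1?eq_sym // addrC.
have [l [r [lr HA]]] :=
    @mirror_pair _ (mirror_arrow id) id _ _ _ _ xy e1 xg yg erefl erefl.
by exists l, r; split=> //; left; exists ((x + y) * Zhalf e)%R.
Qed.

End OddScheme.

Section EvenScheme.

Variable e : nat.
Hypothesis e_gt1 : 1 < e.
Local Notation n := e.*2.+1.
Let e_gt0 : 0 < e := ltnW e_gt1.
Implicit Types x : 'Z_n.

(** The residues [eta] and [shift0] are - 1 / 2 and - 1 / 4. *)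
Definition eta : 'Z_n := (e%:R)%R.
Definition shift0 : 'Z_n := (eta * Zhalf e)%R.

Lemma eta2 : (eta + eta = - 1)%R.
Proof.
by rewrite /eta -natrD addnn; have := @Zm_natB e e_gt0 1 isT; rewrite subSS subn0.
Qed.

Lemma shift02 : (shift0 + shift0 = eta)%R.
Proof. by rewrite /shift0 -mulrDr Zhalf2 // mulr1. Qed.

(** A scheme on the residues modulo [n] and infinity. In the class with centre [g],
reflection pairs all residues except for g, g + eta and g - eta, which form a
triangle, g + shift0, which the class misses, and g - shift0, which is paired with
infinity. The triangle has differences eta, eta and 1, and the reflected pairs
left out have differences 1 and eta. So the pairs with difference eta are met in
two triangles, as they should; those with difference 1 are met in one, and again
in the class that misses infinity, which is the single cycle x, x + 1, x + 2, and
so on. The triangle uses the second half on two of its sides and the long cycle on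
none, so the label bits match all around. *)
Definition even_arrow (c x : option 'Z_n) : arrow (option 'Z_n) :=
  match c, x with
  | None, Some a => Arrow (Some a) (Some (a + 1)%R) (Some false) false
  | None, None => Arrow None None None false
  | Some b, None => Arrow None (Some (b - shift0 - shift0)%R) None false
  | Some b, Some a =>
      let g := (b - shift0)%R in let j := (a - g)%R in
      if (j == - shift0)%R then Arrow None (Some a) None true
      else if (j == - eta)%R then Arrow (Some a) (Some g) (Some false) false
      else if (j == 0)%R then Arrow (Some g) (Some (g + eta)%R) (Some true) false
      else if (j == eta)%R then Arrow (Some a) (Some (g - eta)%R) (Some true) true
      else mirror_arrow Some g a
  end.

Lemma nat_neq0 k : 0 < k < n -> (k%:R != 0 :> 'Z_n)%R.
Proof.
move=> /andP[k0 kn]; apply/eqP => k0'.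
by have := @Zm_nat_inj e e_gt0 k 0 kn isT k0'; lia.
Qed.

Lemma eta_neq0 : eta != 0%R. Proof. by apply: nat_neq0; lia. Qed.

Lemma eta_neqN1 : (eta + 1 != 0)%R.
Proof. by rewrite /eta natr1; apply: nat_neq0; lia. Qed.

Lemma eta_neq1 : (eta - 1 != 0)%R.
Proof.
have -> : (eta = e.-1%:R + 1)%R by rewrite natr1 prednK.
by rewrite addrK; apply: nat_neq0; lia.
Qed.

(** Doubling turns 0, eta, - eta, shift0 and - shift0 into 0, -1, 1, eta and - eta,
which are easier to tell apart. *)
Lemma neq_double (x y z z' : 'Z_n) :
  (x + x = z)%R -> (y + y = z')%R -> (z - z' != 0)%R -> x != y.
Proof. by move=> <- <-; apply: contra => /eqP->; rewrite subrr. Qed.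

Lemma offsets_uniq : uniq [:: 0; eta; - eta; shift0; - shift0]%R.
Proof.
have ne : ((- eta) + (- eta) = 1)%R by rewrite -opprD eta2 opprK.
have ns : ((- shift0) + (- shift0) = - eta)%R by rewrite -opprD shift02.
have z2 : ((0 : 'Z_n) + 0 = 0)%R by rewrite addr0.
have one0 : (1 != 0 :> 'Z_n)%R by apply: (@nat_neq0 1); lia.
have two0 : (1 + 1 != 0 :> 'Z_n)%R by apply: (@nat_neq0 2); lia.
have e1 := neq_double z2 eta2; have e2 := neq_double z2 ne.
have e3 := neq_double z2 shift02; have e4 := neq_double z2 ns.
have e5 := neq_double eta2 ne; have e6 := neq_double eta2 shift02.
have e7 := neq_double eta2 ns; have e8 := neq_double ne shift02.
have e9 := neq_double ne ns; have e10 := neq_double shift02 ns.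
rewrite /= !inE !negb_or e1 ?e2 ?e3 ?e4 ?e5 ?e6 ?e7 ?e8 ?e9 ?e10 //.
- by rewrite opprK eta2 oppr_eq0.
- by rewrite opprK addrC eta_neqN1.
- by rewrite -opprB oppr_eq0 eta_neq1.
- by rewrite opprK addrC eta_neq1.
- by rewrite -opprD oppr_eq0 addrC eta_neqN1.
- by rewrite -opprD oppr_eq0.
- by rewrite opprK add0r eta_neq0.
- by rewrite sub0r oppr_eq0 eta_neq0.
- by rewrite sub0r oppr_eq0.
- by rewrite sub0r opprK.
Qed.

Lemma even_arrow_mirror b j : j \notin [:: 0; eta; - eta; shift0; - shift0]%R ->
  even_arrow (Some b) (Some (b - shift0 + j)%R) =
  mirror_arrow Some (b - shift0)%R (b - shift0 + j)%R.
Proof.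
rewrite !inE !negb_or => /and5P[j0 je jn _ js].
have jE : (b - shift0 + j - (b - shift0) = j)%R by ring.
by rewrite /even_arrow jE (negbTE j0) (negbTE je) (negbTE jn) (negbTE js).
Qed.

Lemma even_arrow_in b :
  even_arrow (Some b) (Some (b - shift0 - eta)%R) =
  Arrow (Some (b - shift0 - eta)%R) (Some (b - shift0)%R) (Some false) false.
Proof.
have jE : (b - shift0 - eta - (b - shift0) = - eta)%R by ring.
have := offsets_uniq; rewrite /= !inE !negb_or => /and5P[_ _ /andP[_ ns] _ _].
by rewrite /even_arrow jE (negbTE ns) eqxx.
Qed.

Lemma even_arrow_center b :
  even_arrow (Some b) (Some (b - shift0)%R) =
  Arrow (Some (b - shift0)%R) (Some (b - shift0 + eta)%R) (Some true) false.
Proof.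
have := offsets_uniq; rewrite /= !inE !negb_or => /and5P[/and4P[_ ne _ ns] _ _ _ _].
by rewrite /even_arrow subrr (negbTE ne) (negbTE ns) eqxx.
Qed.

Lemma even_arrow_out b :
  even_arrow (Some b) (Some (b - shift0 + eta)%R) =
  Arrow (Some (b - shift0 + eta)%R) (Some (b - shift0 - eta)%R) (Some true) true.
Proof.
have jE : (b - shift0 + eta - (b - shift0) = eta)%R by ring.
have := offsets_uniq; rewrite /= !inE !negb_or.
move=> /and5P[/and4P[e0 _ _ _] /and3P[ee _ es] _ _ _].
by rewrite /even_arrow jE (negbTE ee) (negbTE es) eq_sym (negbTE e0) eqxx.
Qed.

Lemma even_arrow_apex b :
  even_arrow (Some b) (Some (b - shift0 - shift0)%R) =
  Arrow None (Some (b - shift0 - shift0)%R) None true.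
Proof.
have jE : (b - shift0 - shift0 - (b - shift0) = - shift0)%R by ring.
by rewrite /even_arrow jE eqxx.
Qed.

Lemma some_neq b j : j != shift0 -> Some (b - shift0 + j)%R != Some b.
Proof.
apply: contra => /eqP[bE]; rewrite -subr_eq0.
have -> : (j - shift0 = (b - shift0 + j) - b)%R by ring.
by rewrite bE subrr.
Qed.

Lemma offsets_opp j : (- j \in [:: 0; eta; - eta; shift0; - shift0])%R =
  (j \in [:: 0; eta; - eta; shift0; - shift0])%R.
Proof.
rewrite !inE oppr_eq0 !eqr_opp !eqr_oppLR.
by case: eqP; case: eqP; case: eqP; case: eqP; case: eqP.
Qed.

Lemma even_mirror_pair b j : j \notin [:: 0; eta; - eta; shift0; - shift0]%R ->
  exists l r, ((l, r) = (Some (b - shift0 + j)%R, Some (b - shift0 - j)%R) \/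
               (l, r) = (Some (b - shift0 - j)%R, Some (b - shift0 + j)%R)) /\
    forall o, exists2 z, z != Some b & even_arrow (Some b) z = Arrow l r None o.
Proof.
move=> jout; have njout : (- j)%R \notin [:: 0; eta; - eta; shift0; - shift0]%R.
  by rewrite offsets_opp.
have neq k : k \notin [:: 0; eta; - eta; shift0; - shift0]%R -> k != shift0.
  by rewrite !inE !negb_or => /and5P[].
have j0 : j != 0%R by move: jout; rewrite inE negb_or => /andP[].
apply: (@mirror_pair e _ even_arrow Some (Some b) (b - shift0)%R).
- apply: contra j0 => /eqP/addrI e1; apply/eqP/(double_inj e_gt0).
  by rewrite {2}e1 subrr addr0.
- by ring.
- exact: some_neq (neq _ jout).
- exact: some_neq (neq _ njout).
- exact: even_arrow_mirror.
- exact: even_arrow_mirror.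
Qed.

Lemma even_pair1 x c : exists g o, exists2 y, y != g &
  even_arrow g y = Arrow (Some x) (Some (x + 1)%R) (Some c) o.
Proof.
case: c; last by exists None, false, (Some x).
pose b := (x - eta + shift0)%R; exists (Some b), true, (Some (b - shift0 + eta)%R).
  by apply: some_neq; have := offsets_uniq; rewrite /= !inE !negb_or => /and5P[_ /and3P[]].
rewrite even_arrow_out /b; congr (Arrow (Some _) (Some _) _ _); first by ring.
have -> : (x + 1 = x - - 1)%R by ring.
by rewrite -eta2; ring.
Qed.

Lemma even_pair_eta x c : exists g o, exists2 y, y != g &
  even_arrow g y = Arrow (Some x) (Some (x + eta)%R) (Some c) o.
Proof.
have := offsets_uniq; rewrite /= !inE !negb_or.
move=> /and5P[/and4P[_ _ s0 _] _ /andP[nes _] _ _].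
case: c.
  pose b := (x + shift0)%R; exists (Some b), false, (Some (b - shift0 + 0)%R).
    exact: some_neq.
  by rewrite addr0 even_arrow_center /b addrK.
pose b := (x + eta + shift0)%R; exists (Some b), false, (Some (b - shift0 - eta)%R).
  exact: some_neq.
by rewrite even_arrow_in /b addrK addrK.
Qed.

Lemma scheme_even : scheme even_arrow.
Proof.
have U := offsets_uniq; move: (U); rewrite /= !inE !negb_or => /and5P[].
move=> /and4P[e0 ne0 s0 ns0] /and3P[ene es ens] /andP[nes nens] sns _.
have apex b o : exists2 z, z != Some b &
    even_arrow (Some b) z = Arrow None (Some (b - shift0 - shift0)%R) None o.
  case: o; last by exists None.
  exists (Some (b - shift0 - shift0)%R); last exact: even_arrow_apex.
  by apply: some_neq; rewrite eq_sym.
split.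
- move=> [b|] [a|] // ab;
    [|by left; exists None, (Some (b - shift0 - shift0)%R); auto|].
    pose j := (a - (b - shift0))%R; have aE : a = (b - shift0 + j)%R by rewrite /j; ring.
    have [jin|jout] := boolP (j \in [:: 0; eta; - eta; shift0; - shift0]%R); last first.
      left; have [l [r [lr HA]]] := even_mirror_pair b jout; exists l, r.
      by split=> //; rewrite aE; case: lr => -[-> ->]; auto.
    have cen : exists2 z, z != Some b & even_arrow (Some b) z =
        Arrow (Some (b - shift0)%R) (Some (b - shift0 + eta)%R) (Some true) false.
      exists (Some (b - shift0)%R); last exact: even_arrow_center.
      by rewrite -[(b - shift0)%R]addr0; apply: some_neq.
    have out : exists2 z, z != Some b & even_arrow (Some b) z =
        Arrow (Some (b - shift0 + eta)%R) (Some (b - shift0 - eta)%R) (Some true) true.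
      by exists (Some (b - shift0 + eta)%R); [apply: some_neq | apply: even_arrow_out].
    have inn : exists2 z, z != Some b & even_arrow (Some b) z =
        Arrow (Some (b - shift0 - eta)%R) (Some (b - shift0)%R) (Some false) false.
      by exists (Some (b - shift0 - eta)%R); [apply: some_neq | apply: even_arrow_in].
    move: cen out inn => [z1 n1 z1E] [z2 n2 z2E] [z3 n3 z3E].
    move: jin; rewrite !inE aE => /or4P[/eqP->|/eqP->|/eqP->|/orP[/eqP j0|/eqP->]].
    + right=> -[].
        by exists z3 => //; exists false; rewrite z3E //; right; rewrite addr0.
      by exists z1 => //; exists true; rewrite z1E //; left; rewrite addr0.
    + right=> -[].
        by exists z2 => //; exists true; rewrite z2E //; left.
      by exists z1 => //; exists true; rewrite z1E //; right.
    + right=> -[].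
        by exists z2 => //; exists true; rewrite z2E //; right.
      by exists z3 => //; exists false; rewrite z3E //; left.
    + by rewrite aE j0 subrK eqxx in ab.
    + by left; exists None, (Some (b - shift0 - shift0)%R); auto.
  right=> -[].
  + by exists (Some (a - 1)%R) => //; exists false => //; right; rewrite /= subrK.
  + by exists (Some a) => //; exists false => //; left.
- have apex_pair a : exists g, forall o, exists2 y, y != g &
      even_arrow g y = Arrow None (Some a) None o.
    exists (Some (a + shift0 + shift0)%R) => o.
    by have := apex (a + shift0 + shift0)%R o; rewrite !addrK.
  move=> [a|] [b|] // ab.
  + pose j := ((b - a) * Zhalf e)%R.
    have j2 : (j + j = b - a)%R by rewrite /j -mulrDr Zhalf2 // mulr1.
    pose c := (a + j + shift0)%R.
    have aE : (c - shift0 - j = a)%R by rewrite /c addrK addrK.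
    have bE : (c - shift0 + j = b)%R by rewrite /c addrK -addrA j2; ring.
    have [jin|jout] := boolP (j \in [:: 0; eta; - eta; shift0; - shift0]%R); last first.
      have [l [r [lr HA]]] := even_mirror_pair c jout; exists l, r.
      rewrite aE bE in lr; split; last by left; exists (Some c).
      by case: lr; [right|left].
    have bE' : (b = a + (j + j))%R by rewrite j2; ring.
    move: jin; rewrite !inE => /or4P[/eqP j0|/eqP j0|/eqP j0|/orP[/eqP j0|/eqP j0]].
    * by rewrite bE' j0 !addr0 eqxx in ab.
    * have -> : (a = b + 1)%R by rewrite bE' j0 eta2; ring.
      by exists (Some b), (Some (b + 1)%R); split; [right | right=> k; apply: even_pair1].
    * have -> : (b = a + 1)%R by rewrite bE' j0 -opprD eta2; ring.
      by exists (Some a), (Some (a + 1)%R); split; [left | right=> k; apply: even_pair1].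
    * have -> : (b = a + eta)%R by rewrite bE' j0 shift02.
      by exists (Some a), (Some (a + eta)%R); split; [left | right=> k; apply: even_pair_eta].
    * have -> : (a = b + eta)%R by rewrite bE' j0 -opprD shift02; ring.
      by exists (Some b), (Some (b + eta)%R); split; [right | right=> k; apply: even_pair_eta].
  + by exists None, (Some a); split; [right | left; apply: apex_pair].
  + by exists None, (Some b); split; [left | left; apply: apex_pair].
Qed.

End EvenScheme.

Theorem theorem1p2 (k t : nat) (hk : 6 <= k) (hk4 : k = 2 %[mod 4])
    (ht : 1 <= t) (hkt : ~ (t = 2 /\ 14 <= k)) :
  exists S : {set subgraph (2 * k * t + 1)}, ARCS k S.
Proof.
have [h h0 ->] : exists2 h, 0 < h & k = 2 * h.*2.+1.
  by exists (k %/ 4); have := divn_eq k 4; rewrite hk4; lia.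
have of_scheme (G : finType) (A : G -> G -> arrow G) : #|G| = t -> scheme A ->
    exists S : {set subgraph (2 * (2 * h.*2.+1) * t + 1)}, ARCS (2 * h.*2.+1) S.
  by move=> cG; rewrite -cG; apply: ARCS_of_scheme; rewrite ?cG.
have cZ e : 0 < e -> #|{: 'Z_e.*2.+1}| = e.*2.+1.
  by move=> e0; rewrite card_ord Zp_cast; lia.
have [t1|[t2|[t4|[odd_t|even_t]]]] : t = 1 \/ t = 2 \/ t = 4 \/
    (0 < t./2 /\ t = t./2.*2.+1) \/ (1 < t.-1./2 /\ t = t.-1./2.*2.+2) by lia.
- by apply: (of_scheme _ _ _ scheme_unit); rewrite card_unit.
- by rewrite t2; apply: ARCS_order2.
- by apply: (of_scheme _ _ _ scheme4); rewrite card_prod card_bool.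
- case: odd_t => e0 te; apply: (of_scheme _ _ _ (scheme_odd e0)).
  by rewrite cZ.
- case: even_t => e1 te; apply: (of_scheme _ _ _ (scheme_even e1)).
  by rewrite card_option cZ // ltnW.
Qed.
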